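(* In the geometric amoebot model with reconfigurable circuits and at least two pins per edge, there is a protocol that lets every connected amoebot structure of $n$ amoebots agree on the chirality (i.e. afterwards all amoebots have the same chirality) after $O(\log n)$ rounds, with high probability.
   Context: Amoebot model with circuits. $G_{eqt}=(V,E)$ is the infinite regular triangular grid graph. A set of $n$ amoebots occupies a finite set $S\subseteq V$ of nodes, $|S|=n$, exactly one amoebot per node of $S$; the induced graph $G_S=G_{eqt}|_S$ is connected; amoebots do not move. Amoebots on adjacent nodes are neighbors and are joined by a bond. All amoebots are anonymous and run the same randomized finite state machine (constant memory, independent of $n$). Each amoebot has a compass orientation (one of the six grid directions) and a chirality (which of the two senses of rotation it regards as clockwise; it may redefine it), and labels its incident edges accordingly. Initially compass orientations and chiralities are arbitrary. Every edge incident to an amoebot carries the same constant number of pins in a fixed linear order; the pins on a bond are shared by the two neighbors; each amoebot labels the pins of an edge in order according to its own chirality, so two neighbors label the shared pins in opposite orders iff they have the same chirality. Each amoebot chooses a pin configuration: an arbitrary set of undirected wires between pins on its own incident edges. If $P$ is the set of all pins and $C$ the set of all wires, a circuit is a connected component of the graph $(P,C)$; an amoebot is part of a circuit iff the circuit contains a pin on one of its bonds. Time proceeds in synchronous rounds; in each round every amoebot reads its memory and the beeps received on its circuits, computes and updates its memory, and then may reconfigure its wires and send a beep on any of its circuits. A beep sent on a circuit is received in the next round by all amoebots of that circuit; an amoebot only learns whether at least one beep was sent on the circuit, not the origin nor the number of senders. Running time is the number of rounds. With high probability: with probability at least $1-1/n^c$ where the constant $c$ can be made arbitrarily large. *)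

(* Defs.v *)
From mathcomp Require Import all_boot all_order all_algebra finmap.

Set Implicit Arguments.
Unset Strict Implicit.
Unset Printing Implicit Defensive.

Import GRing.Theory.
Local Open Scope ring_scope.

(* Nodes of the infinite triangular grid, in the basis formed by the grid
   vectors at angles 0 and 60 degrees. *)
Definition node : Type := (int * int)%type.

(* The six grid directions, counterclockwise; d + 3 is opposite to d. *)
Definition dirvec (d : 'Z_6) : node :=
  nth 0 [:: (1, 0); (0, 1); (-1, 1); (-1, 0); (0, -1); (1, -1)] d.

Definition neighbors (S : {fset node}) : rel S :=
  [rel u v : S | [exists d : 'Z_6, val v == val u + dirvec d]].

Definition amoebot_structure (S : {fset node}) : Prop :=
  S != fset0 /\ forall u v : S, connect (@neighbors S) u v.

(* A pin is a grid edge together with a position among its k pins.  Each edge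
   is named from its endpoint that sees it in one of the directions 0, 1, 2,
   and positions are counted counterclockwise around that endpoint. *)
Definition pin (k : nat) : Type := (node * 'Z_6 * 'I_k)%type.

(* The pin on the edge leaving u in direction d at position p, where p is
   counted counterclockwise around u, hence reversed from the other end. *)
Definition pin_at k (u : node) (d : 'Z_6) (p : 'I_k) : pin k :=
  if (d < 3)%N then (u, d, p) else (u + dirvec d, d + 3%:R, rev_ord p).

Definition pins k (S : {fset node}) : {fset pin k} :=
  [fset pin_at (val x.1.1) x.1.2 x.2 | x : (S * 'Z_6 * 'I_k)%type]%fset.

(* An amoebot's own name for a pin: an edge label, then a pin label. *)
Definition label (k : nat) : finType := ('Z_6 * 'I_k)%type.

(* Pin named l by an amoebot at u with compass orientation o and chirality c.
   The chirality is true when the amoebot's clockwise is the clockwise of the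
   grid; edges (from o on) and the pins of an edge are both numbered in the
   amoebot's own counterclockwise order. *)
Definition own_pin k (u : node) (o : 'Z_6) (c : bool) (l : label k) : pin k :=
  if c then pin_at u (o + l.1) l.2 else pin_at u (o - l.1) (rev_ord l.2).

(* The flag returned by [step] tells whether the amoebot reverses its
   chirality.  The pairs in [wires] are read as undirected wires, and wires and
   beeps are set up from the memory as updated in the current round. *)
Record protocol (k : nat) := Protocol {
  memory : finType;
  start : memory;
  coin : finType;
  step : memory -> {set label k} -> coin -> memory * bool;
  wires : memory -> {set label k * label k};
  beeps : memory -> {set label k};
  final : pred memory
}.

Record amoebot k (A : protocol k) := Amoebot {
  mem : memory A;
  chirality : bool;
  received : {set label k}
}.

Definition config k (A : protocol k) (S : {fset node}) : Type :=
  {ffun S -> amoebot A}.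

Definition named k (A : protocol k) (S : {fset node}) (o : {ffun S -> 'Z_6})
    (g : config A S) (u : S) (l : label k) : pin k :=
  own_pin (val u) (o u) (chirality (g u)) l.

Definition wired k (A : protocol k) (S : {fset node}) (o : {ffun S -> 'Z_6})
    (g : config A S) : rel (pins k S) :=
  [rel x y | [exists u : S, exists w in wires (mem (g u)),
     [|| (val x == named o g u w.1) && (val y == named o g u w.2)
       | (val y == named o g u w.1) && (val x == named o g u w.2)]]].

Definition circuit k (A : protocol k) (S : {fset node}) (o : {ffun S -> 'Z_6})
    (g : config A S) (x : pins k S) : {set pins k S} :=
  [set y | connect (wired o g) x y].

(* Only pins on bonds count: the neighboring node has to be occupied. *)
Definition part_of k (S : {fset node}) (u : S) (K : {set pins k S}) : bool :=
  [exists y in K, exists d : 'Z_6, exists p : 'I_k,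
     (val u + dirvec d \in S) && (val y == pin_at (val u) d p)].

Definition has_beep k (A : protocol k) (S : {fset node})
    (o : {ffun S -> 'Z_6}) (g : config A S) (K : {set pins k S}) : bool :=
  [exists y in K, exists v : S, exists l in beeps (mem (g v)),
     part_of v K && (val y == named o g v l)].

Definition deliver k (A : protocol k) (S : {fset node})
    (o : {ffun S -> 'Z_6}) (g : config A S) : config A S :=
  [ffun u => Amoebot (mem (g u)) (chirality (g u))
     [set l | [exists x : pins k S,
        [&& val x == named o g u l, part_of u (circuit o g x)
          & has_beep o g (circuit o g x)]]]].

(* A final memory is absorbing: the amoebot has terminated. *)
Definition update k (A : protocol k) (a : amoebot A) (r : coin A) : amoebot A :=
  if final (mem a) then a else
  let: (q, b) := step (mem a) (received a) r in
  Amoebot q (chirality a (+) b) set0.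

Definition round k (A : protocol k) (S : {fset node}) (o : {ffun S -> 'Z_6})
    (g : config A S) (r : {ffun S -> coin A}) : config A S :=
  deliver o [ffun u => update (g u) (r u)].

Definition init k (A : protocol k) (S : {fset node}) (c : {ffun S -> bool}) :
    config A S :=
  [ffun u => Amoebot (start A) (c u) set0].

(* The coins of all amoebots in T rounds, one entry per round. *)
Definition coins k (A : protocol k) (S : {fset node}) (T : nat) : finType :=
  T.-tuple {ffun S -> coin A}.

Definition run k (A : protocol k) (S : {fset node}) (o : {ffun S -> 'Z_6})
    (c : {ffun S -> bool}) (T : nat) (w : coins A S T) : config A S :=
  foldl (round o) (init A c) w.

Definition terminated k (A : protocol k) (S : {fset node}) (g : config A S) :
    bool :=
  [forall u, final (mem (g u))].

Definition same_chirality k (A : protocol k) (S : {fset node})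
    (g : config A S) : bool :=
  [forall u, forall v, chirality (g u) == chirality (g v)].

Definition uniform_prob (W : finType) (E : pred W) : rat :=
  #|E|%:R / #|W|%:R.

(* Main.v *)
From HB Require Import structures.
Require Import Defs.
From mathcomp Require Import all_boot all_order all_algebra finmap.
From mathcomp Require Import zify.
(* [Defs] is imported again because MathComp has its own [mem]. *)
Import Defs.

Set Implicit Arguments.
Unset Strict Implicit.
Unset Printing Implicit Defensive.

Import Order.TTheory GRing.Theory Num.Theory.
Local Open Scope ring_scope.

(* The first and the last pin of every edge carry two tracks.  If across each
   bond the own track of one amoebot meets the own (other) track of a neighbor
   of equal (opposite) chirality, then there are exactly two circuits, one for
   each chirality.  Assigning the two pins of an edge to the tracks needs
   symmetry breaking, which is done by the first toss in which the coins of the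
   two ends differ; before that, both pins are on both tracks, so that all of
   the structure is one circuit.

   In each phase the amoebots toss one coin each, and the candidates with heads
   beep on the circuit of their chirality.  If exactly one circuit carries a
   beep, everybody adopts its chirality and halts.  If both do, the candidates
   with tails withdraw.

   Consider 2m phases.  If the structure has not halted, then one of the
   following happened: the coins of two amoebots agreed throughout the first m
   phases (an unassigned edge); the coins of two candidates of opposite
   chirality agreed throughout the last m phases, because both tossed heads
   whenever somebody beeped, and both tossed tails otherwise; or, when the
   remaining candidates have one chirality, some amoebot tossed only tails in
   the last m phases.  Each of these at most 2 n^2 + n events has probability
   2^-m. *)

(** * Bonds and pin names *)

Lemma Z6_cases (P : 'Z_6 -> Prop) :
  P 0 -> P 1 -> P 2%:R -> P 3%:R -> P 4%:R -> P 5%:R -> forall d, P d.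
Proof.
move=> P0 P1 P2 P3 P4 P5 [[|[|[|[|[|[|//]]]]]] lt_d].
- by rewrite (_ : Ordinal _ = 0) //; apply/val_inj.
- by rewrite (_ : Ordinal _ = 1) //; apply/val_inj.
- by rewrite (_ : Ordinal _ = 2%:R) //; apply/val_inj.
- by rewrite (_ : Ordinal _ = 3%:R) //; apply/val_inj.
- by rewrite (_ : Ordinal _ = 4%:R) //; apply/val_inj.
- by rewrite (_ : Ordinal _ = 5%:R) //; apply/val_inj.
Qed.

Lemma addZ6_33 (d : 'Z_6) : d + 3%:R + 3%:R = d.
Proof. by rewrite -addrA (_ : 3%:R + 3%:R = 0) ?addr0 //; apply/val_inj. Qed.

Lemma dirvec_opp (d : 'Z_6) : dirvec (d + 3%:R) = - dirvec d.
Proof. by move: d; apply: Z6_cases. Qed.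

Lemma dirvec_neq0 (d : 'Z_6) : dirvec d != 0.
Proof. by move: d; apply: Z6_cases. Qed.

Lemma ltn3_opp (d : 'Z_6) : ((d + 3%:R)%R < 3)%N = ~~ (d < 3)%N.
Proof. by move: d; apply: Z6_cases. Qed.

Lemma pin_at_opp k (u : node) d (p : 'I_k) :
  pin_at (u + dirvec d) (d + 3%:R) (rev_ord p) = pin_at u d p.
Proof.
rewrite /pin_at ltn3_opp; case: (d < 3)%N => //=.
by rewrite dirvec_opp addrK addZ6_33 rev_ordK.
Qed.

(** The normal form of an edge is taken from its end with direction below 3, so the only second name
    of a pin is the one from the other end. *)
Lemma pin_at_inj k (u v : node) d e (p q : 'I_k) :
  pin_at u d p = pin_at v e q ->
  [/\ u = v, d = e & p = q] \/
  [/\ v = u + dirvec d, e = d + 3%:R & q = rev_ord p].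
rewrite /pin_at; case: ifP => d3; case: ifP => e3.
- by case=> -> -> ->; left.
- case=> -> -> ->; right.
  by rewrite dirvec_opp addrK addZ6_33 rev_ordK.
- by case=> <- <- <-; right.
- move=> E; left.
  have de : d = e by have /= := congr1 (fun x : pin k => x.1.2) E; exact: addIr.
  have pq : p = q by have /= := congr1 (fun x : pin k => x.2) E; exact: rev_ord_inj.
  split=> //; have /= := congr1 (fun x : pin k => x.1.1) E; rewrite de; exact: addIr.
Qed.

Section Geometry.

Variables (k : nat) (S : {fset node}) (o : {ffun S -> 'Z_6}) (c : S -> bool).

Definition heading (u : S) (a : 'Z_6) : 'Z_6 := if c u then o u + a else o u - a.

Definition own_label (u : S) (d : 'Z_6) : 'Z_6 := if c u then d - o u else o u - d.

Lemma own_labelK u : cancel (own_label u) (heading u).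
Proof.
by move=> d; rewrite /heading /own_label; case: (c u); [rewrite addrC subrK | rewrite subKr].
Qed.

Lemma heading_inj u : injective (heading u).
Proof. by rewrite /heading => a b; case: ifP => _ /addrI // /oppr_inj. Qed.

(* The edge that u calls a is the bond that v calls b. *)
Definition bond (u : S) (a : 'Z_6) (v : S) (b : 'Z_6) : bool :=
  (val v == val u + dirvec (heading u a)) && (heading v b == heading u a + 3%:R).

Definition bonded (u : S) (a : 'Z_6) : bool := [exists v, exists b, bond u a v b].

Lemma bondedP u a : reflect (exists v b, bond u a v b) (bonded u a).
Proof.
apply: (iffP existsP) => [[v /existsP[b ?]]|[v [b ?]]]; first by exists v, b.
by exists v; apply/existsP; exists b.
Qed.

Lemma bond_sym u a v b : bond u a v b = bond v b u a.
Proof.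
suff imp u' a' v' b' : bond u' a' v' b' -> bond v' b' u' a' by apply/idP/idP; apply: imp.
case/andP=> /eqP vE /eqP hv; rewrite /bond vE hv dirvec_opp addrK eqxx /=.
by rewrite addZ6_33.
Qed.

Lemma bond_fun u a v b v' b' : bond u a v b -> bond u a v' b' -> v' = v /\ b' = b.
Proof.
case/andP=> /eqP vE /eqP hb /andP[/eqP v'E /eqP hb'].
have vv : v' = v by apply/val_inj; rewrite v'E vE.
by split=> //; rewrite vv in hb'; apply: (@heading_inj v); rewrite hb hb'.
Qed.

Lemma bond_neq u a v b : bond u a v b -> u != v.
Proof.
case/andP=> /eqP vE _; apply/eqP=> uv; move: vE; rewrite -uv.
by move/eqP; rewrite addrC -subr_eq subrr eq_sym (negPf (dirvec_neq0 _)).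
Qed.

Lemma neighborsP u v : reflect (exists a b, bond u a v b) (neighbors u v).
Proof.
apply: (iffP existsP) => [[d /eqP uv]|[a [b /andP[uv _]]]]; last by exists (heading u a).
exists (own_label u d), (own_label v (d + 3%:R)).
by rewrite /bond !own_labelK uv !eqxx.
Qed.

Lemma own_pin_in (u : S) (l : label k) : own_pin (val u) (o u) (c u) l \in pins k S.
Proof.
rewrite /own_pin; case: ifP => _; apply/imfsetP.
  by exists (u, o u + l.1, l.2).
by exists (u, o u - l.1, rev_ord l.2).
Qed.

Definition own (u : S) (l : label k) : pins k S := FSetSub (own_pin_in u l).

(* The number of a pin at the other end of a bond. *)
Definition flip (u v : S) (p : 'I_k) : 'I_k := if c u == c v then rev_ord p else p.

Lemma own_pinE (u : S) (l : label k) :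
  own_pin (val u) (o u) (c u) l =
  pin_at (val u) (heading u l.1) (if c u then l.2 else rev_ord l.2).
Proof. by rewrite /own_pin /heading; case: ifP. Qed.

(** Seen from the other end, the pins of an edge come in reversed order; opposite chiralities undo
    this reversal, hence the two cases of [flip]. *)
Lemma own_bond u a v b p : bond u a v b -> own v (b, flip u v p) = own u (a, p).
Proof.
case/andP=> /eqP vE /eqP hb; apply/val_inj; rewrite /= !own_pinE /= vE hb.
rewrite -[RHS]pin_at_opp /flip; congr pin_at.
by case: (c u); case: (c v); rewrite ?rev_ordK.
Qed.

Lemma own_eq u l v l' : own u l = own v l' ->
  u = v /\ l = l' \/ bond u l.1 v l'.1 /\ l'.2 = flip u v l.2.
Proof.
move/(congr1 val); rewrite /= !own_pinE => /pin_at_inj[[uv hh pp]|[vE hE pE]].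
  left; have {}uv : u = v by apply/val_inj.
  subst v; split=> //; move/heading_inj: hh pp.
  case: l l' => [a p] [b q] /= ->; case: ifP => _; first by move=> ->.
  by move/rev_ord_inj->.
right; rewrite /bond vE hE !eqxx; split=> //; rewrite /flip.
by case: (c u) pE; case: (c v) => /= pE; rewrite -[l'.2]rev_ordK pE ?rev_ordK -?pE ?rev_ordK.
Qed.

Lemma own_inj u : injective (own u).
Proof.
move=> l l' /own_eq[[]//|[/bond_neq]]; by rewrite eqxx.
Qed.

Lemma part_ofP u (K : {set pins k S}) :
  reflect (exists a p, bonded u a /\ own u (a, p) \in K) (part_of u K).
Proof.
apply: (iffP existsP) => [[y /andP[yK /existsP[d /existsP[p /andP[vS /eqP yE]]]]]|].
  exists (own_label u d), (if c u then p else rev_ord p); split.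
    apply/bondedP; exists (FSetSub vS), (own_label (FSetSub vS) (d + 3%:R)).
    by rewrite /bond !own_labelK !eqxx.
  rewrite (_ : own _ _ = y) //; apply/val_inj; rewrite /= own_pinE yE /= own_labelK.
  by case: (c u); rewrite ?rev_ordK.
move=> [a [p [/bondedP[v [b /andP[/eqP vE _]]] inK]]].
exists (own u (a, p)); rewrite inK /=; apply/existsP; exists (heading u a).
apply/existsP; exists (if c u then p else rev_ord p).
by rewrite -vE fsvalP /= own_pinE.
Qed.

Lemma bonded_exists u v : connect (@neighbors S) u v -> u != v -> exists a, bonded u a.
Proof.
case/connectP=> [[|w p] /= path_p ->]; first by rewrite eqxx.
case/andP: path_p => /neighborsP[a [b ab]] _ _; exists a; apply/bondedP; by exists w, b.
Qed.

End Geometry.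

(** * Delivery of beeps *)

Section Deliver.

Variables (k : nat) (A : protocol k) (S : {fset node}) (o : {ffun S -> 'Z_6}).
Variables (c : S -> bool) (g : config A S).
Hypothesis gc : forall u, chirality (g u) = c u.

Lemma named_own u l : named o g u l = val (own o c u l).
Proof. by rewrite /named gc. Qed.

Lemma eq_named_own (x : pins k S) u l : (val x == named o g u l) = (x == own o c u l).
Proof. by rewrite named_own. Qed.

Lemma deliver_mem u : mem (deliver o g u) = mem (g u).
Proof. by rewrite ffunE. Qed.

Lemma deliver_chirality u : chirality (deliver o g u) = chirality (g u).
Proof. by rewrite ffunE. Qed.

Lemma in_received u l :
  (l \in received (deliver o g u)) =
  part_of u (circuit o g (own o c u l)) && has_beep o g (circuit o g (own o c u l)).
Proof.
rewrite ffunE /= inE; apply/existsP/idP => [[x]|b].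
  by rewrite eq_named_own => /andP[/eqP->].
by exists (own o c u l); rewrite eq_named_own eqxx.
Qed.

Lemma has_beepP (K : {set pins k S}) :
  reflect (exists v l, [/\ l \in beeps (mem (g v)), own o c v l \in K & part_of v K])
          (has_beep o g K).
Proof.
apply: (iffP existsP) => [[y /andP[yK /existsP[v /existsP[l /and3P[lv pK]]]]]|].
  by rewrite eq_named_own => /eqP yE; exists v, l; rewrite -yE.
move=> [v [l [lv inK pK]]]; exists (own o c v l); rewrite inK andTb.
apply/existsP; exists v; apply/existsP; exists l.
by rewrite lv pK eq_named_own eqxx.
Qed.

Lemma wiredP x y :
  reflect (exists u l l', [/\ ((l, l') \in wires (mem (g u))) || ((l', l) \in wires (mem (g u))),
                             x = own o c u l & y = own o c u l'])
          (wired o g x y).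
Proof.
apply: (iffP existsP) => [[u /existsP[[l l'] /andP[lw]]]|].
  rewrite !eq_named_own /=; case/orP=> /andP[/eqP-> /eqP->].
    by exists u, l, l'; rewrite lw.
  by exists u, l', l; rewrite lw orbT.
move=> [u [l [l' [/orP[lw|lw] -> ->]]]]; exists u; apply/existsP.
  by exists (l, l'); rewrite lw !eq_named_own !eqxx.
by exists (l', l); rewrite lw !eq_named_own !eqxx orbT.
Qed.

Hypothesis unwired : forall u, wires (mem (g u)) = set0.

Lemma unwired_circuit x : circuit o g x = [set x].
Proof.
apply/setP=> y; rewrite !inE; apply/idP/eqP => [|->]; last exact: connect0.
case/connectP=> [[|z p] //= /andP[/wiredP[u [l [l' []]]]]].
by rewrite unwired !inE.
Qed.

Lemma unbonded_received u a p : ~~ bonded o c u a -> ((a, p) \in received (deliver o g u)) = false.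
Proof.
move=> ub; rewrite in_received unwired_circuit; apply/negbTE; apply: contra ub.
case/andP=> /(part_ofP o c)[a' [p' [ba']]].
by rewrite inE => /eqP/own_inj[<-].
Qed.

(** Without wires every circuit is a single pin, so a pin on a bond carries just the beeps of the
    two ends of that bond. *)
Lemma bond_received u a v b p : bond o c u a v b ->
  ((a, p) \in received (deliver o g u)) =
  ((a, p) \in beeps (mem (g u))) || ((b, flip c u v p) \in beeps (mem (g v))).
Proof.
move=> uv; rewrite in_received unwired_circuit.
have pu : part_of u [set own o c u (a, p)].
  apply/(part_ofP o c); exists a, p; rewrite inE eqxx; split=> //.
  by apply/bondedP; exists v, b.
rewrite pu /=; apply/has_beepP/orP => [[w [l [lw]]]|].
  rewrite inE => /eqP/esym/own_eq[[uw lE]|[/= uw lE]] _; first by left; rewrite uw lE.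
  have [wE bE] := bond_fun uv uw; right.
  by case: l lw uw wE bE lE => /= b' q lw _ <- <- <-.
case=> bp; first by exists u, (a, p); rewrite inE.
have oE := own_bond p uv.
exists v, (b, flip c u v p); split; first exact: bp.
  by rewrite inE oE.
apply/(part_ofP o c); exists b, (flip c u v p); rewrite inE oE; split; last exact: eqxx.
by apply/bondedP; exists u, a; rewrite bond_sym.
Qed.

End Deliver.

Lemma amoebot_eq k (A : protocol k) (a b : amoebot A) :
  mem a = mem b -> chirality a = chirality b -> received a = received b -> a = b.
Proof. by case: a b => [m x r] [m' x' r'] /= -> -> ->. Qed.

(** Delivery reads only memories and chiralities, which it preserves. So [deliver o g = g] can serve
    as the invariant that the beeps of [g] have been received, and facts about [deliver o g] apply
    to [g] itself. *)
Lemma deliver_idem k (A : protocol k) (S : {fset node}) (o : {ffun S -> 'Z_6}) (g : config A S) :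
  deliver o (deliver o g) = deliver o g.
Proof.
apply/ffunP=> u.
have gc v : chirality (deliver o g v) = chirality (g v) by rewrite deliver_chirality.
apply: amoebot_eq; [exact: deliver_mem | exact: deliver_chirality |].
have cE : circuit o (deliver o g) =1 circuit o g.
  move=> x; apply/setP=> y; rewrite !inE; apply: eq_connect => {}x {}y.
  apply: eq_existsb => v; rewrite deliver_mem; apply: eq_existsb => w.
  by rewrite /named deliver_chirality.
apply/setP=> l; rewrite (in_received o gc) (in_received o (fun=> erefl)) !cE; congr andb.
apply/(has_beepP o gc)/(has_beepP o (fun=> erefl)) => -[v [l' H]]; exists v, l'.
  by move: H; rewrite deliver_mem.
by rewrite deliver_mem.
Qed.

(** * Tracks *)

Local Notation edge_states := {ffun 'Z_6 -> option bool}.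

(* The state [t d] of edge [d] is [Some b] when the first pin is assigned to
   track [b] and the last pin to track [~~ b]; while it is [None] both pins are
   on both tracks. *)
Definition track k (t : edge_states) (s : bool) (l : label k.+2) : bool :=
  (l.2 == ord0) && (t l.1 != Some (~~ s)) || (l.2 == ord_max) && (t l.1 != Some s).

Definition heard k (t : edge_states) (R : {set label k.+2}) (s : bool) : bool :=
  [exists l, track t s l && (l \in R)].

Lemma track_exists k (t : edge_states) s a :
  exists p : 'I_k.+2, track t s (a, p).
Proof.
have [ta|ta] := boolP (t a == Some (~~ s)); last by exists ord0; rewrite /track /= ta.
by exists ord_max; rewrite /track /= (eqP ta) eqxx /=; case: s {ta}.
Qed.

Lemma rev_ord0 k : rev_ord (ord0 : 'I_k.+1) = ord_max.
Proof. by apply/val_inj; rewrite /= subn1. Qed.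

Lemma rev_ord_max k : rev_ord (ord_max : 'I_k.+1) = ord0.
Proof. by rewrite -rev_ord0 rev_ordK. Qed.

Section Tracks.

Variables (k : nat) (S : {fset node}) (o : {ffun S -> 'Z_6}) (c : S -> bool).
Variable t : S -> edge_states.

Hypothesis opposite_ends :
  forall u a v b, bond o c u a v b -> t v b = omap negb (t u a).

Definition resolved : bool := [forall u, forall a, t u a != None].

(* Track [tau] of the structure is the union of the tracks [true] of the
   amoebots of chirality [tau] and the tracks [false] of the others. *)
Definition gtrack (tau : bool) (u : S) (l : label k.+2) : bool :=
  track (t u) (tau == c u) l.

(** For equal chiralities the pins are reversed and the negated state reverses the tracks back; for
    opposite chiralities the pins stay, and the negated state matches the exchange of own and other
    track. *)
Lemma gtrack_bond tau u a v b p : bond o c u a v b ->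
  gtrack tau v (b, flip c u v p) = gtrack tau u (a, p).
Proof.
move=> uv; rewrite /gtrack /track /= (opposite_ends uv) /flip.
have r0 : (rev_ord p == ord0) = (p == ord_max).
  by rewrite -[ord0]rev_ordK (inj_eq rev_ord_inj) rev_ord0.
have rm : (rev_ord p == ord_max) = (p == ord0).
  by rewrite -[ord_max]rev_ordK (inj_eq rev_ord_inj) rev_ord_max.
case: (c u); case: (c v); rewrite /= ?r0 ?rm;
  by case: tau; case: (t u a) => [[]|]; case: (p == ord0); case: (p == ord_max).
Qed.

Lemma gtrack_own tau u l v l' : own o c u l = own o c v l' -> gtrack tau u l = gtrack tau v l'.
Proof.
case/own_eq=> [[-> ->] //|[]]; case: l l' => [a p] [b q] /= uv ->.
by rewrite (gtrack_bond _ _ uv).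
Qed.

Lemma gtrack_resolved tau tau' u l :
  resolved -> gtrack tau u l -> gtrack tau' u l -> tau = tau'.
Proof.
move=> /forallP/(_ u)/forallP/(_ l.1); rewrite /gtrack /track.
have [->|_] := eqVneq l.2 ord0; have [E|_] := eqVneq _ ord_max => //=.
  by case: (t u l.1) => [[]|//] _; case: (c u) tau tau' => -[] [].
by case: (t u l.1) => [[]|//] _; case: (c u) tau tau' => -[] [].
Qed.

Hypothesis conn : forall u v : S, connect (@neighbors S) u v.
Hypothesis two : forall u : S, exists v, u != v.

Lemma bonded_ex u : exists a, bonded o c u a.
Proof. by have [v uv] := two u; apply: (bonded_exists o c (conn u v) uv). Qed.

Variables (A : protocol k.+2) (g : config A S) (b : S -> bool).
Hypothesis gc : forall u, chirality (g u) = c u.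
Hypothesis gw : forall u,
  wires (mem (g u)) = [set w | [exists s, track (t u) s w.1 && track (t u) s w.2]].
Hypothesis gb : forall u,
  beeps (mem (g u)) = if b u then [set l | track (t u) true l] else set0.

Lemma wired_track tau u l l' : gtrack tau u l -> gtrack tau u l' ->
  connect (wired o g) (own o c u l) (own o c u l').
Proof.
move=> ul ul'; apply: connect1; apply/(wiredP o gc); exists u, l, l'; split=> //.
by rewrite gw inE /=; apply/orP; left; apply/existsP; exists (tau == c u); rewrite -[X in X && _]/(gtrack tau u l) ul.
Qed.

(** Induction along a path from [u] to [v]: an amoebot wires all its pins of one track together, and
    every edge has a pin on each track, so the circuit can cross the next bond. *)
Lemma gtrack_connect tau u l v l' : gtrack tau u l -> gtrack tau v l' ->
  connect (wired o g) (own o c u l) (own o c v l').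
Proof.
have /connectP[p path_p ->] := conn u v.
elim: p u l path_p => [|w p IH] u l /=; first by move=> _; apply: wired_track.
case/andP=> /neighborsP-/(_ o c)[a [a' uw]] path_p ul vl'.
have [p0 up0] := track_exists k (t u) (tau == c u) a.
apply: (connect_trans (wired_track ul up0)).
rewrite -(own_bond p0 uw); apply: IH => //.
by rewrite (gtrack_bond _ _ uw).
Qed.

(** The first pin of an unassigned edge lies on both tracks and joins them. *)
Lemma unresolved_connect tau u l tau' v l' : ~~ resolved ->
  gtrack tau u l -> gtrack tau' v l' ->
  connect (wired o g) (own o c u l) (own o c v l').
Proof.
case/forallPn=> w /forallPn[a]; rewrite negbK => /eqP wa ul vl'.
have wt tau0 : gtrack tau0 w (a, ord0) by rewrite /gtrack /track /= wa.
exact: connect_trans (gtrack_connect ul (wt tau)) (gtrack_connect (wt tau') vl').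
Qed.

Lemma resolved_connect tau u l v l' : resolved ->
  connect (wired o g) (own o c u l) (own o c v l') ->
  gtrack tau u l -> gtrack tau v l'.
Proof.
move=> res con ul.
(* The pins of track [tau] are closed under wires: a wire joins two pins of a common track, and in a
   resolved structure no pin lies on a second one. *)
pose T := [pred y : pins k.+2 S | [exists u, exists l, (y == own o c u l) && gtrack tau u l]].
have TP u0 l0 : (own o c u0 l0 \in T) = gtrack tau u0 l0.
  rewrite inE; apply/existsP/idP => [[u1 /existsP[l1 /andP[/eqP/gtrack_own->]]]//|ul0].
  by exists u0; apply/existsP; exists l0; rewrite eqxx.
suff cl : closed (wired o g) T by rewrite -TP -(closed_connect cl con) TP.
move=> x y /(wiredP o gc)[w [m [m' [mw -> ->]]]]; rewrite !TP.
have {mw} [s /andP[wm wm']] : exists s, track (t w) s m && track (t w) s m'.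
  by case/orP: mw; rewrite gw inE /= => /existsP[s /andP[? ?]]; exists s; apply/andP.
have gs n : track (t w) s n -> gtrack (s == c w) w n.
  by rewrite /gtrack; case: s {wm wm'} (c w) => -[].
by apply/idP/idP=> wn; [rewrite (gtrack_resolved res wn (gs _ wm)) (gs _ wm')
  | rewrite (gtrack_resolved res wn (gs _ wm')) (gs _ wm)].
Qed.

(** The circuit of a pin on track [s] of [u] is the track [s == c u] of the structure, or both
    tracks together while an edge is unassigned; every beeping amoebot beeps on the track of its own
    chirality. *)
Lemma track_received u s l : track (t u) s l ->
  (l \in received (deliver o g u)) =
  [exists v, b v && (~~ resolved || (c v == (s == c u)))].
Proof.
move=> usl; rewrite (in_received o gc).
set tau := s == c u; have ul : gtrack tau u l.
  by move: usl; rewrite /gtrack /tau; case: (s) (c u) => -[].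
(* A track meets every edge of [v], in particular one that leads to a neighbor, as [part_of]
   demands. *)
have part_track v tau' m (K : {set pins k.+2 S}) : gtrack tau' v m ->
    (forall m', gtrack tau' v m' -> own o c v m' \in K) -> part_of v K.
  move=> vm inK; have [a va] := bonded_ex v.
  have [p vp] := track_exists k (t v) (tau' == c v) a.
  by apply/(part_ofP o c); exists a, p; split=> //; apply: inK.
have -> : part_of u (circuit o g (own o c u l)).
  by apply: (part_track _ _ _ _ ul) => m um; rewrite inE; apply: wired_track ul um.
apply/(has_beepP o gc)/existsP => [[v [m [mv]]]|[v /andP[bv cv]]].
  rewrite inE gb in mv *; case: (boolP (b v)) mv => [bv mv con _|_]; last by rewrite inE.
  exists v; rewrite bv; case: (boolP resolved) => //= res.
  rewrite inE in mv; have vm : gtrack (c v) v m by rewrite /gtrack eqxx.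
  by apply/eqP/esym/(gtrack_resolved res (resolved_connect res con ul) vm).
(* Edge 0 may lead to an empty node: a beep can be sent on any pin of a circuit that also contains a
   bond pin of [v]. *)
have [m vm] : exists m, gtrack (c v) v m.
  by have [p vp] := track_exists k (t v) (c v == c v) 0; exists (0, p).
have con m' : gtrack (c v) v m' -> connect (wired o g) (own o c u l) (own o c v m').
  case/orP: cv => [nres|/eqP cv] vm'; first exact: unresolved_connect nres ul vm'.
  by apply: gtrack_connect ul _; rewrite -/tau -cv.
exists v, m; split; first by rewrite gb bv inE; move: vm; rewrite /gtrack eqxx.
  by rewrite inE; apply: con.
by apply: (part_track _ _ _ _ vm) => m' vm'; rewrite inE; apply: con.
Qed.

Lemma heard_received u s :
  heard (t u) (received (deliver o g u)) s =
  [exists v, b v && (~~ resolved || (c v == (s == c u)))].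
Proof.
rewrite /heard; apply/existsP/idP => [[l /andP[ul]]|h].
  by rewrite (track_received ul).
have [p up] := track_exists k (t u) s 0.
by exists (0, p); rewrite up (track_received up).
Qed.

End Tracks.

(** * The protocol *)

Variant stage := Compare | Toss | Listen | Halt.

Definition nat_of_stage s :=
  match s with Compare => 0 | Toss => 1 | Listen => 2 | Halt => 3 end%N.

Definition stage_of_nat n :=
  match n with 0 => Compare | 1 => Toss | 2 => Listen | _ => Halt end%N.

Lemma nat_of_stageK : cancel (inord \o nat_of_stage : stage -> 'I_4) stage_of_nat.
Proof. by case; rewrite /= inordK. Qed.

HB.instance Definition _ := Finite.copy stage (can_type nat_of_stageK).

(* Stage, coin, candidacy, the set of edges whose ends have equal chirality,
   and the state of each edge. *)
Definition agreement_memory : finType :=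
  (stage * bool * bool * {set 'Z_6} * edge_states)%type.

Definition stage_of (m : agreement_memory) : stage := m.1.1.1.1.

(* In stage [Compare] everybody beeps on its first pins, which are the last pins
   of the neighbors of equal chirality.  In stage [Toss] heads beep on the first
   pins and tails on the last: the coins of the ends of a bond differ iff exactly
   one of its two pins beeps (equal chirality) or both do (opposite chirality).
   Without a neighbor no pin beeps, and the edge is assigned at once. *)
Definition agreement_step k (m : agreement_memory) (R : {set label k.+2}) (r : bool) :
    agreement_memory * bool :=
  let: (s, x, a, K, t) := m in
  match s with
  | Compare => ((Toss, r, a, [set d | (d, ord_max) \in R], t), false)
  | Toss =>
      ((Listen, x, a, K,
        [ffun d => if (((d, ord0) \in R) == ((d, ord_max) \in R)) (+) (d \in K)
                   then Some x else t d]), false)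
  | Listen =>
      let own := heard t R true in
      let other := heard t R false in
      if own == other then ((Compare, x, a && (own ==> x), K, t), false)
      else ((Halt, x, a, K, t), other)
  | Halt => (m, false)
  end.

Definition agreement_wires k (m : agreement_memory) : {set label k.+2 * label k.+2} :=
  let: (s, x, a, K, t) := m in
  match s with
  | Listen => [set w | [exists s, track t s w.1 && track t s w.2]]
  | _ => set0
  end.

Definition agreement_beeps k (m : agreement_memory) : {set label k.+2} :=
  let: (s, x, a, K, t) := m in
  match s with
  | Compare => [set l | l.2 == ord0]
  | Toss => [set l | l.2 == if x then ord0 else ord_max]
  | Listen => if a && x then [set l | track t true l] else set0
  | Halt => set0
  end.

(** Beeps are set up only by an update, so the run starts in an idle [Listen]: nothing has been
    received, and everybody moves on to [Compare] as after a silent phase. The initial coin is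
    tails, so that nobody would beep in the initial configuration. *)
Definition agreement k : protocol k.+2 :=
  @Protocol k.+2 agreement_memory (Listen, false, true, set0, [ffun=> None])
    bool (@agreement_step k) (@agreement_wires k) (@agreement_beeps k)
    (fun m => if stage_of m is Halt then true else false).

(** * One phase: the rounds [Compare], [Toss] and [Listen] *)

Section Phase.

Variables (k : nat) (S : {fset node}) (o : {ffun S -> 'Z_6}) (c : S -> bool).
Hypothesis conn : forall u v : S, connect (@neighbors S) u v.
Hypothesis two : forall u : S, exists v, u != v.

Local Notation config := (config (agreement k) S).

Definition at_stage s (x a : S -> bool) (K : S -> {set 'Z_6})
    (t : S -> edge_states) (g : config) : Prop :=
  forall u, mem (g u) = (s, x u, a u, K u, t u) /\ chirality (g u) = c u.

Definition halted (g : config) : Prop :=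
  exists b, forall u, stage_of (mem (g u)) = Halt /\ chirality (g u) = b.

(** An edge is reassigned whenever the coins of its ends differ, even if it was assigned before. An
    assigned edge never becomes unassigned, and an edge without a neighbor is assigned at once. *)
Definition new_state (x : S -> bool) (t : S -> edge_states) (u : S) :
    edge_states :=
  [ffun d => if [exists v, exists e, bond o c u d v e && (x u == x v)]
             then t u d else Some (x u)].

Lemma new_state_bond x t u d v e : bond o c u d v e ->
  new_state x t u d = if x u == x v then t u d else Some (x u).
Proof.
move=> uv; rewrite ffunE; congr (if _ then _ else _).
apply/existsP/idP => [[v' /existsP[e' /andP[uv' xv]]]|xv].
  by have [<- _] := bond_fun uv uv'.
by exists v; apply/existsP; exists e; rewrite uv.
Qed.

Lemma roundE (g : config) (r : {ffun S -> bool}) u :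
  mem (round o g r u) = mem (update (g u) (r u)) /\
  chirality (round o g r u) = chirality (update (g u) (r u)).
Proof. by rewrite /round deliver_mem deliver_chirality ffunE. Qed.

Lemma deliver_round (g : config) (r : {ffun S -> bool}) :
  deliver o (round o g r) = round o g r.
Proof. exact: deliver_idem. Qed.

Lemma halted_round (g : config) (r : {ffun S -> bool}) : halted g -> halted (round o g r).
Proof.
case=> b gb; exists b => u; have [gs gc] := gb u; have [-> ->] := roundE g r u.
by rewrite /update /= gs.
Qed.

Lemma at_stage_chirality s x a K t g : at_stage s x a K t g -> forall u, chirality (g u) = c u.
Proof. by move=> gs u; case: (gs u). Qed.

Definition same_ends (K : S -> {set 'Z_6}) : Prop :=
  (forall u d v e, bond o c u d v e -> (d \in K u) = (c u == c v)) /\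
  (forall u d, ~~ bonded o c u d -> d \notin K u).

Lemma ord_max_neq0 : ((ord_max : 'I_k.+2) == ord0) = false.
Proof. by []. Qed.

(** Only first pins beep, so a beep on a last pin comes from the neighbor, whose first pin it is iff
    the chiralities agree. *)
Lemma compare_round x a K t g (r : {ffun S -> bool}) :
  at_stage Compare x a K t g -> deliver o g = g ->
  exists2 K', same_ends K' & at_stage Toss r a K' t (round o g r).
Proof.
move=> gs gd; have gc := at_stage_chirality gs.
have gw u : wires (mem (g u)) = set0 by rewrite (gs u).1.
exists (fun u => [set d | (d, ord_max) \in received (g u)]).
  split=> [u d v e uv|u d ub]; rewrite inE -gd; last by rewrite (unbonded_received gc gw).
  rewrite (bond_received gc gw _ uv) !(gs _).1 /= !inE /= /flip.
  by case: (c u == c v); rewrite ?rev_ord_max.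
move=> u; have [-> ->] := roundE g r u.
by rewrite /update /= (gs u).1 /= (gs u).2 addbF.
Qed.

Lemma toss_round x a K t g (r : {ffun S -> bool}) :
  at_stage Toss x a K t g -> deliver o g = g -> same_ends K ->
  at_stage Listen x a K (new_state x t) (round o g r).
Proof.
move=> gs gd [Kb Ku]; have gc := at_stage_chirality gs.
have gw u : wires (mem (g u)) = set0 by rewrite (gs u).1.
move=> u; have [-> ->] := roundE g r u.
rewrite /update /= (gs u).1 /= (gs u).2 addbF; split=> //; congr (_, _).
apply/ffunP=> d; rewrite ffunE -gd.
have [/bondedP[v [e uv]]|ub] := boolP (bonded o c u d); last first.
  rewrite !(unbonded_received gc gw) // (negPf (Ku _ _ ub)) /= ffunE.
  case: existsP => // -[v /existsP[e /andP[uv _]]]; case/bondedP: ub; by exists v, e.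
rewrite (new_state_bond _ _ uv) !(bond_received gc gw _ uv) (Kb _ _ _ _ uv) !(gs _).1 /= !inE /= /flip.
by case: (c u == c v); case: (x u); case: (x v); rewrite ?rev_ord0 ?rev_ord_max ?ord_max_neq0 ?eqxx.
Qed.

(** Whether the circuit of chirality [tau] carries a beep; before all edges are assigned, any beep
    counts for both. *)
Definition hears (x a : S -> bool) (t : S -> edge_states) (tau : bool) : bool :=
  [exists v, (a v && x v) && (~~ resolved t || (c v == tau))].

(** All amoebots receive the same two bits, swapped according to chirality, so they all take the
    same branch. When halting, an amoebot reverses iff the beep was on its other track, and thus
    adopts the chirality that beeped. *)
Lemma listen_round x a K t g (r : {ffun S -> bool}) :
  at_stage Listen x a K t g -> deliver o g = g ->
  (forall u d v e, bond o c u d v e -> t v e = omap negb (t u d)) ->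
  if hears x a t true == hears x a t false
  then at_stage Compare x (fun u => a u && (hears x a t true ==> x u)) K t (round o g r)
  else halted (round o g r).
Proof.
move=> gs gd ends; have gc := at_stage_chirality gs.
have heardE u s : heard (t u) (received (g u)) s = hears x a t (s == c u).
  rewrite -gd; apply: (heard_received ends conn two gc) => v; by rewrite (gs v).1.
case: eqP => [hh|hh].
  move=> u; have [-> ->] := roundE g r u.
  rewrite /update /= (gs u).1 /= !heardE.
  have -> : hears x a t (true == c u) = hears x a t true by case: (c u).
  have -> : hears x a t (false == c u) = hears x a t true by case: (c u).
  by rewrite eqxx (gs u).2 addbF.
(* Exactly one chirality beeped, and it is [true] iff [hears x a t true]. *)
exists (hears x a t true) => u; have [-> ->] := roundE g r u.
rewrite /update /= (gs u).1 /= !heardE (gs u).2.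
case: (c u) hh => /=; case: (hears x a t true); case: (hears x a t false) => //.
Qed.

(** With equal coins both ends keep their states; with different coins they store opposite ones. *)
Lemma new_state_opposite x (t : S -> edge_states) :
  (forall u d v e, bond o c u d v e -> t v e = omap negb (t u d)) ->
  (forall u d v e, bond o c u d v e -> new_state x t v e = omap negb (new_state x t u d)).
Proof.
move=> ends u d v e uv; rewrite (new_state_bond _ _ uv) (new_state_bond x t (u := v) (d := e) (v := u) (e := d)) 1?bond_sym //.
by rewrite (ends _ _ _ _ uv); case: (x u); case: (x v).
Qed.

Lemma new_state_None x (t : S -> edge_states) u d : new_state x t u d = None ->
  t u d = None /\ exists v e, bond o c u d v e /\ x u = x v.
Proof.
rewrite ffunE; case: existsP => // -[v /existsP[e /andP[uv /eqP xv]]] tu.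
by split=> //; exists v, e.
Qed.

End Phase.

(** * Runs *)

Section Trajectory.

Variables (k : nat) (S : {fset node}) (o : {ffun S -> 'Z_6}) (c : {ffun S -> bool}).
Hypothesis conn : forall u v : S, connect (@neighbors S) u v.
Hypothesis two : forall u : S, exists v, u != v.
Variable r : nat -> {ffun S -> bool}.

Local Notation config := (config (agreement k) S).

Fixpoint trajectory (n : nat) : config :=
  if n is n'.+1 then round o (trajectory n') (r n') else init (agreement k) c.

Definition running (a : S -> bool) (t : S -> edge_states) (g : config) : Prop :=
  (exists x K, at_stage c Compare x a K t g) /\ deliver o g = g.

Definition opposite (t : S -> edge_states) : Prop :=
  forall u d v e, bond o c u d v e -> t v e = omap negb (t u d).

Lemma phase a t g (r1 r2 r3 : {ffun S -> bool}) : running a t g -> opposite t ->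
  let t' := new_state o c r1 t in
  if hears c r1 a t' true == hears c r1 a t' false
  then running (fun u => a u && (hears c r1 a t' true ==> r1 u)) t'
         (round o (round o (round o g r1) r2) r3)
  else halted (round o (round o (round o g r1) r2) r3).
Proof.
move=> [[x [K gs]] gd] opp t'.
have [K' same gs1] := compare_round r1 gs gd.
have gs2 := toss_round r2 gs1 (deliver_round _ _ _) same.
have := listen_round conn two r3 gs2 (deliver_round _ _ _) (new_state_opposite r1 opp).
case: ifP => _ gs3; last exact: gs3.
by split; [exists r1, K'; exact: gs3 | exact: deliver_round].
Qed.

Lemma deliver_init : deliver o (init (agreement k) c) = init (agreement k) c.
Proof.
have gc u : chirality (init (agreement k) c u) = c u by rewrite ffunE.
apply/ffunP=> u; apply: amoebot_eq; [exact: deliver_mem | exact: deliver_chirality |].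
rewrite [RHS](_ : _ = set0); last by rewrite ffunE.
apply/setP=> l; rewrite inE (in_received o gc) andbC.
case: (has_beepP o gc) => [[v [l' [+ _ _]]]|_]; last by [].
by rewrite ffunE /= inE.
Qed.

Lemma running_start : running (fun=> true) (fun=> [ffun=> None]) (trajectory 1).
Proof.
have gs : at_stage c Listen (fun=> false) (fun=> true) (fun=> set0) (fun=> [ffun=> None])
            (init (agreement k) c) by move=> u; rewrite ffunE.
have h tau : hears c (fun=> false) (fun=> true) (fun=> [ffun=> None]) tau = false.
  by apply/existsP=> -[].
have := listen_round conn two (r 0%N) gs deliver_init.
rewrite !h eqxx => gs1; split; last exact: deliver_round.
exists (fun=> false), (fun=> set0); apply: gs1 => u d v e _; by rewrite !ffunE.
Qed.

(** Round 0 is the idle [Listen]; after it each phase takes three rounds, and its coin is read in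
    the first of them. *)
Definition toss (i : nat) : {ffun S -> bool} := r (3 * i + 1)%N.

Variables (u0 : S) (m : nat).
Hypothesis early : forall u v, u != v -> exists2 i, (i < m)%N & toss i u != toss i v.

(** The invariant after [j] phases without halting. The claims on candidates start at phase [m],
    because by then [early] forces all edges to be assigned and the two circuits are separate. *)
Definition progress (j : nat) (g : config) : Prop :=
  exists a t,
  [/\ running a t g,
      opposite t,
      exists u, a u,
      forall u d, t u d = None -> forall i, (i < j)%N ->
        exists v e, bond o c u d v e /\ toss i u = toss i v &
      (forall u v, a u -> a v -> c u != c v ->
         forall i, (m <= i < j)%N -> toss i u = toss i v) /\
      ((exists u v, [/\ a u, a v & c u != c v]) \/
       (forall u, a u -> forall i, (m <= i < j)%N -> toss i u = false))].

Lemma progress_step j g (r2 r3 : {ffun S -> bool}) : progress j g ->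
  halted (round o (round o (round o g (toss j)) r2) r3) \/
  progress j.+1 (round o (round o (round o g (toss j)) r2) r3).
Proof.
move=> [a [t [run opp [u1 au1] unres [pairs cases]]]].
set g' := round _ _ _; set x := toss j; set t' := new_state o c x t.
have := phase x r2 r3 run opp; rewrite -/g' /= -/t'; case: eqP => hh; last by left.
move=> run'; right; exists (fun u => a u && (hears c x a t' true ==> x u)), t'.
have unres' u d : t' u d = None -> forall i, (i < j.+1)%N ->
    exists v e, bond o c u d v e /\ toss i u = toss i v.
  move=> tu i; have [/unres tu' xv] := new_state_None tu.
  by rewrite ltnS leq_eqVlt => /predU1P[->|/tu'].
(* An unassigned edge would have ends whose coins agreed in all phases up to [j], against [early];
   the toss [i0] provides the neighbor [v] at that edge. *)
have res : (m <= j)%N -> resolved t'.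
  move=> mj; apply/forallP=> u; apply/forallP=> d; apply/eqP=> tu.
  have [v0 uv0] := two u; have [i0 i0m _] := early uv0.
  have [|v [e [uv _]]] := unres' _ _ tu i0; first by lia.
  have [i im] := early (bond_neq uv); apply/negP; rewrite negbK.
  have [|v' [e' [uv']]] := unres' _ _ tu i; first by lia.
  by have [-> _] := bond_fun uv uv' => ->.
split=> //; first exact: new_state_opposite.
  case: (boolP (hears c x a t' true)) => [/existsP[v /andP[/andP[av xv] _]]|_].
    by exists v; rewrite av xv.
  by exists u1; rewrite au1.
(* Before phase [m] the range of phases is empty, so the pair claim and the tails alternative are
   vacuous. *)
have [mj|jm] := leqP m j; last first.
  split; first by move=> u v _ _ _ i; lia.
  by right => u _ i; lia.
have hearsE tau : hears c x a t' tau = [exists v, (a v && x v) && (c v == tau)].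
  by rewrite /hears (res mj).
have window i : (m <= i < j.+1)%N -> i = j \/ (m <= i < j)%N by lia.
(* If both circuits beep, all remaining candidates tossed heads, and a beeping candidate of each
   chirality remains. *)
case: (boolP (hears c x a t' true)) => h1 /=.
  move: hh; rewrite h1 => /esym; move: h1; rewrite !hearsE.
  case/existsP=> v1 /andP[/andP[av1 xv1] cv1] /existsP[v2 /andP[/andP[av2 xv2] cv2]].
  split.
    move=> u v /andP[au xu] /andP[av xv] uv i /window[->|]; first by rewrite -/x xu xv.
    exact: pairs.
  by left; exists v1, v2; rewrite av1 av2 xv1 xv2 (eqP cv1) (eqP cv2).
(* If neither circuit beeps, every candidate tossed tails and none withdraws. *)
have silent u : a u -> x u = false.
  move=> au; apply/negP=> xu; case/negP: h1.
  case: (boolP (c u)) => cu; last rewrite hh; rewrite hearsE; apply/existsP; exists u.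
    by rewrite au xu cu.
  by rewrite au xu (negPf cu).
split.
  move=> u v /andP[au _] /andP[av _] uv i /window[->|]; last exact: pairs.
  by rewrite -/x !silent.
case: cases => [[u [v [au av uv]]]|tails]; first by left; exists u, v; rewrite au av.
by right=> u /andP[au _] i /window[->|]; [exact: silent | exact: tails].
Qed.

Lemma halted_trajectory n n' : (n <= n')%N -> halted (trajectory n) -> halted (trajectory n').
Proof.
elim: n' => [|n' IH]; first by rewrite leqn0 => /eqP->.
rewrite leq_eqVlt => /predU1P[->//|/IH{}IH /IH]; exact: halted_round.
Qed.

Lemma progress_or_halted j : halted (trajectory (3 * j + 1)) \/ progress j (trajectory (3 * j + 1)).
Proof.
elim: j => [|j [hj|pj]].
- right; exists (fun=> true), (fun=> [ffun=> None]); split.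
  + exact: running_start.
  + by move=> u d v e _; rewrite !ffunE.
  + by exists u0.
  + by [].
  + split; first by move=> u v _ _ _ i; rewrite ltn0 andbF.
    by right=> u _ i; rewrite ltn0 andbF.
- by left; apply: halted_trajectory hj; lia.
- rewrite (_ : 3 * j.+1 + 1 = (3 * j + 1).+3)%N; last lia.
  exact: progress_step.
Qed.

(** Otherwise the invariant after [m'] phases leaves two candidates of opposite chirality, against
    [late], or a candidate with only tails since phase [m], against [heads]. *)
Lemma trajectory_halted m' n :
  (forall u v, u != v -> exists2 i, (m <= i < m')%N & toss i u != toss i v) ->
  (forall u, exists2 i, (m <= i < m')%N & toss i u) ->
  (3 * m' + 1 <= n)%N -> halted (trajectory n).
Proof.
move=> late heads le_n; have [h|[a [t [_ _ [u au] _ [pairs cases]]]]] := progress_or_halted m'.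
  exact: halted_trajectory le_n h.
case: cases => [[v [w [av aw vw]]]|tails].
  have [|i im] := late v w; first by apply: contraNneq vw => ->.
  by rewrite (pairs _ _ av aw vw i im) eqxx.
by have [i im] := heads u; rewrite (tails _ au _ im).
Qed.

End Trajectory.

(** * Probability *)

Lemma foldl_trajectory k (S : {fset node}) (o : {ffun S -> 'Z_6}) (c : {ffun S -> bool})
    (x0 : {ffun S -> bool}) (s : seq {ffun S -> bool}) :
  foldl (round o) (init (agreement k) c) s = trajectory k o c (nth x0 s) (size s).
Proof.
suff takeE n : (n <= size s)%N -> trajectory k o c (nth x0 s) n =
    foldl (round o) (init (agreement k) c) (take n s) by rewrite takeE // take_size.
elim: n => [|n IH] lt_n; first by rewrite take0.
by rewrite (take_nth x0) // foldl_rcons /= IH // ltnW.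
Qed.

Lemma halted_terminated k (S : {fset node}) (g : config (agreement k) S) :
  halted g -> terminated g && same_chirality g.
Proof.
case=> b gb; apply/andP; split; apply/forallP=> u; first by rewrite /= (gb u).1.
by apply/forallP=> v; rewrite (gb u).2 (gb v).2.
Qed.

(** * Counting outcomes of coin tosses *)

Lemma card_flip (X : finType) (P : pred X) (f : X -> X) :
  involutive f -> (forall x, P (f x) = ~~ P x) -> (2 * #|P| = #|X|)%N.
Proof.
move=> ff Pf; rewrite -(cardC P) mul2n -addnn; congr addn.
rewrite -(card_image (inv_inj ff)); apply: eq_card => x.
rewrite !inE; apply/imageP/idP => [[y Py ->]|nPx]; first by rewrite -[f y \in P]/(P (f y)) Pf negbK.
by exists (f x); rewrite ?ff // -[f x \in P]/(P (f x)) Pf.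
Qed.

Definition flip_at (S : finType) (u : S) (f : {ffun S -> bool}) : {ffun S -> bool} :=
  [ffun v => f v (+) (v == u)].

Lemma flip_atK (S : finType) (u : S) : involutive (flip_at u).
Proof. by move=> f; apply/ffunP=> v; rewrite !ffunE -addbA addbb addbF. Qed.

(** Flipping the coin of [u] leaves that of [v] alone, so it exchanges agreement and
    disagreement. *)
Lemma card_coin_eq (S : finType) (u v : S) : u != v ->
  (2 * #|[pred f : {ffun S -> bool} | f u == f v]| = #|{ffun S -> bool}|)%N.
Proof.
move=> uv; apply: card_flip (flip_atK u) _ => f /=.
by rewrite !ffunE eqxx eq_sym [v == u]eq_sym (negPf uv) addbF addbT; case: (f u) (f v) => -[].
Qed.

Lemma card_coin_false (S : finType) (u : S) :
  (2 * #|[pred f : {ffun S -> bool} | ~~ f u]| = #|{ffun S -> bool}|)%N.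
Proof.
by apply: card_flip (flip_atK u) _ => f /=; rewrite ffunE eqxx addbT.
Qed.

(** Independence of rounds in counting form: an event of probability 1/2 occurs in all of [m]
    distinct rounds with probability 2^-m. *)
Lemma card_tuple_half (X : finType) (P : pred X) T m (pos : 'I_m -> 'I_T) :
  (2 * #|P| = #|X|)%N -> injective pos ->
  (#|[pred w : T.-tuple X | [forall i, P (tnth w (pos i))]]| * 2 ^ m = #|X| ^ T)%N.
Proof.
move=> half pos_inj.
(* The tuples form a product with one factor per round: [P] at the chosen rounds, everything
   elsewhere. *)
pose F j := if j \in codom pos then P else predT.
have -> : #|[pred w : T.-tuple X | [forall i, P (tnth w (pos i))]]| =
          #|(family F : pred {ffun 'I_T -> X})|.
  rewrite -!sum1_card (reindex (fun f : {ffun 'I_T -> X} => [tuple f i | i < T])) /=; last first.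
    apply: onW_bij; exists (fun w => [ffun i => tnth w i]) => [f|w].
      by apply/ffunP=> i; rewrite ffunE tnth_mktuple.
    by apply: eq_from_tnth => i; rewrite tnth_mktuple ffunE.
  apply: eq_bigl => f; rewrite inE; apply/forallP/familyP => [h j|h i].
    rewrite /F; case: codomP => // -[i ->].
    by have := h i; rewrite tnth_mktuple.
  by have := h (pos i); rewrite /F codom_f tnth_mktuple.
rewrite card_family foldrE big_map big_enum /=.
rewrite (bigID (fun j => j \in codom pos)) /=.
have -> : (\prod_(j < T | j \in codom pos) #|F j| = #|P| ^ m)%N.
  rewrite (eq_bigr (fun=> #|P|)) => [|j jc]; last by rewrite /F jc.
  by rewrite prod_nat_const card_codom // card_ord.
have -> : (\prod_(j < T | j \notin codom pos) #|F j| = #|X| ^ (T - m))%N.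
  rewrite (eq_bigr (fun=> #|X|)) => [|j jc]; last by rewrite /F (negPf jc); apply: eq_card.
  rewrite prod_nat_const; congr expn.
  by have := cardC (ssrbool.mem (codom pos)); rewrite card_codom // !card_ord => E; rewrite -[in RHS]E addKn.
have le_mT : (m <= T)%N by have := leq_card pos pos_inj; rewrite !card_ord.
by rewrite mulnAC -expnMn [(_ * 2)%N]mulnC half -expnD subnKC.
Qed.

Lemma union_bound (W I : finType) (Q : I -> pred W) q N :
  (forall i, #|Q i| * q <= N)%N ->
  (#|[pred w | [exists i, Q i w]]| * q <= #|I| * N)%N.
Proof.
move=> QN.
apply: (@leq_trans ((\sum_i #|Q i|) * q)); last first.
  rewrite big_distrl /= -sum_nat_const; exact: leq_sum.
rewrite leq_mul2r; apply/orP; right.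
under eq_bigr do rewrite -sum1_card big_mkcond.
rewrite exchange_big -sum1_card big_mkcond /=; apply: leq_sum => w _.
rewrite inE; case: (boolP [exists i, Q i w]) => // /existsP[i Qi].
by rewrite (bigD1 i) //= [in X in (_ <= X + _)%N]unfold_in Qi.
Qed.

(** * The bad events and their total probability *)

Section Bound.

Variables (S : finType) (m T : nat).
Hypothesis mT : (6 * m < T)%N.

Local Notation X := {ffun S -> bool}.

Lemma window_subproof (b : bool) (i : 'I_m) : (3 * (b * m + i) + 1 < T)%N.
Proof. by have := ltn_ord i; case: b => /=; lia. Qed.

(* The round in which the coin of phase [b * m + i] is tossed. *)
Definition window (b : bool) (i : 'I_m) : 'I_T := Ordinal (window_subproof b i).

Lemma window_inj b : injective (window b).
Proof. by move=> i j /(congr1 val) /= E; apply/val_inj => /=; lia. Qed.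

(** The bit [b] selects the first or the last [m] phases. Pairs with [u = v] stay in the index type,
    with an empty event, to keep the number of events simple. *)
Definition bad (e : bool * (S * S) + S) (w : T.-tuple X) : bool :=
  match e with
  | inl (b, (u, v)) => (u != v) && [forall i, tnth w (window b i) u == tnth w (window b i) v]
  | inr u => [forall i, ~~ tnth w (window true i) u]
  end.

Lemma card_bad e : (#|bad e| * 2 ^ m <= #|X| ^ T)%N.
Proof.
case: e => [[b [u v]]|u]; last first.
  by rewrite -(card_tuple_half (card_coin_false u) (@window_inj true)).
have [->|uv] := eqVneq u v.
  by rewrite eq_card0 ?mul0n // => w; rewrite unfold_in /= eqxx.
rewrite -(card_tuple_half (card_coin_eq uv) (@window_inj b)) leq_mul2r.
by apply/orP; right; apply: eq_leq; apply: eq_card => w; rewrite !unfold_in /= uv.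
Qed.

Lemma card_some_bad :
  (#|[pred w | [exists e, bad e w]]| * 2 ^ m <= (2 * (#|S| * #|S|) + #|S|) * #|X| ^ T)%N.
Proof.
apply: leq_trans (union_bound card_bad) _.
by rewrite card_sum !card_prod card_bool.
Qed.

End Bound.

(** Both [n] and 4 are at most 2^(2L), and [2 n^2 + n <= 4 n^2]. This gives three factors 2^(2L),
    and [c] more from [n ^ c], hence the exponent [(2 c + 6) L]. *)
Lemma pow2_bound n c : (1 < n)%N ->
  ((2 * (n * n) + n) * n ^ c <= 2 ^ ((2 * c + 6) * trunc_log 2 n))%N.
Proof.
move=> n1; set L := trunc_log 2 n.
have L0 : (0 < L)%N by rewrite trunc_log_gt0.
have nL : (n <= 2 ^ (2 * L))%N.
  by apply: leq_trans (ltnW (trunc_log_ltn n (ltnSn 1))) _; rewrite leq_exp2l //; lia.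
have four : (4 <= 2 ^ (2 * L))%N by rewrite -[4%N]/(2 ^ 2)%N leq_exp2l //; lia.
apply: (@leq_trans (2 ^ (2 * L) * (2 ^ (2 * L) * 2 ^ (2 * L)) * (2 ^ (2 * L)) ^ c)).
  apply: leq_mul; last by case: (c) => // c'; rewrite leq_exp2r.
  by apply: leq_trans (leq_mul four (leq_mul nL nL)); nia.
by rewrite -expnM -!expnD leq_exp2l //; lia.
Qed.

Lemma good_run k (S : {fset node}) (o : {ffun S -> 'Z_6}) (c : {ffun S -> bool}) m T
    (mT : (6 * m < T)%N) (w : T.-tuple {ffun S -> bool}) :
  amoebot_structure S -> (1 < #|{: S}|)%N -> ~~ [exists e, bad mT e w] ->
  let g := run (A := agreement k) o c w in terminated g && same_chirality g.
Proof.
move=> [/fset0Pn[u0 u0S] conn] S2 good; apply: halted_terminated.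
rewrite /run (foldl_trajectory _ _ _ [ffun=> false]) size_tuple.
have two u : exists v : S, u != v.
  have [v _ uv] : exists2 v : S, v \in predT & v \notin pred1 u.
    by apply/subsetPn/negP => /subset_leq_card; rewrite card1 leqNgt S2.
  by exists v; rewrite eq_sym; move: uv; rewrite inE.
have tossE (b : bool) (i : 'I_m) u : toss (nth [ffun=> false] w) (b * m + i) u = tnth w (window mT b i) u.
  by rewrite /toss (tnth_nth [ffun=> false]).
have equal (b : bool) u v : u != v -> exists i : 'I_m, tnth w (window mT b i) u != tnth w (window mT b i) v.
  move=> uv; apply/existsP; rewrite -negb_forall; apply: contra good => all_eq.
  by apply/existsP; exists (inl (b, (u, v))); rewrite /= uv.
(* The first [m] phases assign all edges; the next [m] settle the candidates. *)
apply: (@trajectory_halted k S o c conn two _ [` u0S]%fset m _ (m + m)).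
- move=> u v uv; have [i] := equal false u v uv; rewrite -!tossE mul0n add0n => ne.
  by exists i.
- move=> u v uv; have [i] := equal true u v uv; rewrite -!tossE mul1n => ne.
  by exists (m + i)%N => //; have := ltn_ord i; lia.
- move=> u; have [i] : exists i, tnth w (window mT true i) u.
    apply/existsP; rewrite -[X in is_true X]negbK negb_exists; apply: contra good => all_tails.
    by apply/existsP; exists (inr u).
  rewrite -tossE mul1n => ne.
  by exists (m + i)%N => //; have := ltn_ord i; lia.
- by lia.
Qed.

Theorem corollary3p6 (k : nat) (two_pins : (2 <= k)%N) :
  exists A : protocol k,
  forall c : nat, exists C : nat,
  forall (S : {fset node}) (n : nat) (compass : {ffun S -> 'Z_6})
    (chirality0 : {ffun S -> bool}),
    amoebot_structure S -> #|` S|%fset = n ->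
    1 - 1 / n%:R ^+ c <=
      uniform_prob [pred w : coins A S (C * trunc_log 2 n) |
        terminated (run compass chirality0 w)
        && same_chirality (run compass chirality0 w)].
Proof.
case: k two_pins => [|[|k]] // _.
(* With [m = (2 c + 6) L] for [L = trunc_log 2 n], the [2 m] phases take [6 m] rounds; the extra 1
   adds [L > 0] rounds, which cover the initial one. *)
exists (agreement k) => c; exists (6 * (2 * c + 6) + 1)%N => S n compass chirality0 Sconn Sn.
set T := (_ * _)%N; rewrite /uniform_prob /=.
set good := [pred w | _].
have n0 : (0 < n)%N by rewrite -Sn cardfs_gt0; case: Sconn.
(* For [n = 1] no round is run, but the claimed lower bound is 0. *)
have [n1|n1] := leqP n 1.
  have -> : n = 1%N by lia.
  by rewrite expr1n divr1 subrr divr_ge0.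
set m := ((2 * c + 6) * trunc_log 2 n)%N.
have mT : (6 * m < T)%N.
  have : (0 < trunc_log 2 n)%N by rewrite trunc_log_gt0.
  by rewrite /T /m; lia.
have cardS : #|{: S}| = n by rewrite -Sn cardfE.
pose some_bad := [pred w | [exists e, @bad S m T mT e w]].
have bad_good : (#|predC good| <= #|some_bad|)%N.
  apply/subset_leq_card/subsetP => w; rewrite !inE; apply: contraNT => no_bad.
  by apply: (good_run k compass chirality0 Sconn _ no_bad); rewrite cardS.
(* After multiplication by 2^m, this combines the count of bad outcomes with the choice of [m]. *)
have few : (#|predC good| * n ^ c <= #|{: coins (agreement k) S T}|)%N.
  rewrite -(@leq_pmul2r (2 ^ m)) ?expn_gt0 //.
  rewrite card_tuple /=.
  have B := card_some_bad S mT; rewrite cardS in B.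
  have P := pow2_bound c n1.
  apply: (@leq_trans (n ^ c * (#|some_bad| * 2 ^ m))).
    by rewrite mulnAC mulnC leq_mul2l leq_mul2r bad_good !orbT.
  apply: leq_trans (leq_mul (leqnn _) B) _.
  by rewrite mulnA [(n ^ c * _)%N]mulnC [X in (_ <= X)%N]mulnC leq_mul2r P orbT.
have W := cardC good; set N := #|{: _}| in few W *.
have N0 : (0 < N)%N.
  by rewrite /N card_tuple expn_gt0 card_ffun card_bool expn_gt0.
(* Since good and remaining outcomes add up to [N], clearing denominators turns the claim into
   [few]. *)
rewrite ler_pdivlMr ?ltr0n // mulrBl lerBlDr !mul1r -[X in X%:R <= _]W natrD lerD2l.
rewrite mulrC ler_pdivlMr ?exprn_gt0 ?ltr0n // -natrX -natrM ler_nat.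
exact: few.
Qed.
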